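(* Let $R$ be a $J$-Noetherian Bezout domain which is not a ring of stable range 1. Then there exists a nonunit element $a\in R$ which is adequate.
   Context: Rings are commutative with identity. A Bezout domain is an integral domain in which every finitely generated ideal is principal. An ideal of $R$ is called a $J$-radical ideal if it is the intersection of all maximal ideals containing it; $R$ is $J$-Noetherian if it satisfies the ascending chain condition on $J$-radical ideals (equivalently, the space of maximal ideals of $R$ with the Zariski topology is Noetherian). A ring $R$ has stable range 1 if for all $a,b\in R$ with $aR+bR=R$ there is $t\in R$ with $(a+bt)R=R$. An element $a$ of a domain $R$ is adequate if for every $b\in R$ there exist $r,s\in R$ such that: (1) $a=rs$; (2) $rR+bR=R$; (3) $s'R+bR\neq R$ for every $s'\in R$ such that $sR\subseteq s'R\neq R$. *)

(* Defs.v *)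
From HB Require Import structures.
From mathcomp Require Import all_boot all_order all_algebra.
From mathcomp Require Import boolp classical_sets.

Set Implicit Arguments.
Unset Strict Implicit.
Unset Printing Implicit Defensive.

Import GRing.Theory.
Local Open Scope classical_set_scope.
Local Open Scope ring_scope.

(* MathComp's [idealr] (ring_quotient) covers only proper ideals given by
   boolean predicates; the unit ideal must be allowed here, both as the sum of
   comaximal ideals and as the (empty) intersection of maximal ideals. *)
Definition is_ideal (R : comPzRingType) (I : set R) : Prop :=
  [/\ I 0,
      forall x y, I x -> I y -> I (x + y)
    & forall c x, I x -> I (c * x)].

Definition principal_ideal (R : comPzRingType) (a : R) : set R :=
  [set x | exists c, x = a * c].

Definition ideal_sum (R : comPzRingType) (I J : set R) : set R :=
  [set z | exists x y, [/\ I x, J y & z = x + y]].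

Definition generated_ideal (R : comPzRingType) (n : nat) (g : 'I_n -> R) :
    set R :=
  [set x | exists c : 'I_n -> R, x = \sum_(i < n) g i * c i].

Definition finitely_generated (R : comPzRingType) (I : set R) : Prop :=
  exists (n : nat) (g : 'I_n -> R), I = generated_ideal g.

Definition bezout_domain (R : idomainType) : Prop :=
  forall I : set R, is_ideal I -> finitely_generated I ->
    exists d : R, I = principal_ideal d.

Definition maximal_ideal (R : comPzRingType) (M : set R) : Prop :=
  [/\ is_ideal M, M <> [set: R]
    & forall I : set R, is_ideal I -> M `<=` I -> I = M \/ I = [set: R]].

Definition J_radical_ideal (R : comPzRingType) (I : set R) : Prop :=
  is_ideal I /\
  I = \bigcap_(M in [set M : set R | maximal_ideal M /\ I `<=` M]) M.

Definition J_noetherian (R : comPzRingType) : Prop :=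
  forall I : nat -> set R,
    (forall n, J_radical_ideal (I n)) ->
    (forall n, I n `<=` I n.+1) ->
    exists N : nat, forall n : nat, (N <= n)%N -> I n = I N.

Definition stable_range1 (R : comPzRingType) : Prop :=
  forall a b : R,
    ideal_sum (principal_ideal a) (principal_ideal b) = [set: R] ->
    exists t : R, principal_ideal (a + b * t) = [set: R].

Definition adequate (R : idomainType) (a : R) : Prop :=
  forall b : R, exists r s : R,
    [/\ a = r * s,
        ideal_sum (principal_ideal r) (principal_ideal b) = [set: R]
      & forall s' : R,
          principal_ideal s `<=` principal_ideal s' ->
          principal_ideal s' <> [set: R] ->
          ideal_sum (principal_ideal s') (principal_ideal b) <> [set: R]].

(* Main.v *)
Require Import Defs.
From mathcomp Require Import all_boot all_order all_algebra.
From mathcomp Require Import boolp classical_sets.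
Import GRing.Theory.
Local Open Scope ring_scope.

(** Write [V x] for the set of maximal ideals containing [x], and [J x] for
    their intersection.  The idea is to take a nonunit [a] whose [V a] is
    minimal among the nonempty sets [V x], that is, whose [J a] is maximal among
    the proper ideals [J x]; the ascending chain condition on J-radical ideals
    provides one ([exists_maximal_jacobson]).

    By minimality every nonunit divisor [g] of [a] satisfies [V g = V a].  Let
    [b] be arbitrary, and let [g] generate [aR + bR].  Either [g] is a unit and
    the factorization [a = a * 1] shows adequacy at [b], or [g] is a nonunit
    divisor of [a] and the factorization [a = 1 * a] does: [b], being a multiple
    of [g], lies in every maximal ideal of [V a], while each nonunit divisor of
    [a] lies in all of these ideals too, so it is not coprime to [b].  (In fact
    [V a] is a single point.)

    Krull's theorem ([proper_ideal_sub_maximal]) enters because [V x] must be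
    nonempty as soon as [x] is a nonunit. *)

Local Open Scope classical_set_scope.

Section Ideals.
Set Implicit Arguments.
Unset Strict Implicit.
Variable R : comPzRingType.
Implicit Types (I J M : set R) (x y a b : R).

Lemma ideal1_setT {I} : is_ideal I -> I 1 -> I = [set: R].
Proof.
move=> [_ _ IM] I1; apply/seteqP; split=> // x _.
by rewrite -[x]mulr1; apply: IM.
Qed.

Lemma principal_is_ideal x : is_ideal (principal_ideal x).
Proof.
split=> [|y z [c ->] [d ->]|c y [d ->]]; first by exists 0; rewrite mulr0.
  by exists (c + d); rewrite mulrDr.
by exists (c * d); rewrite mulrCA.
Qed.

Lemma mem_principal_self x : principal_ideal x x.
Proof. by exists 1; rewrite mulr1. Qed.

Lemma ideal_sum_is_ideal I J :
  is_ideal I -> is_ideal J -> is_ideal (ideal_sum I J).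
Proof.
move=> [I0 ID IM] [J0 JD JM]; split.
- by exists 0, 0; split; rewrite ?addr0.
- move=> _ _ [x [y [Ix Jy ->]]] [z [t [Iz Jt ->]]].
  by exists (x + z), (y + t); split; [apply: ID|apply: JD|rewrite addrACA].
- move=> c _ [x [y [Ix Jy ->]]].
  by exists (c * x), (c * y); split; [apply: IM|apply: JM|rewrite mulrDr].
Qed.

Lemma principal_sum_finitely_generated a b :
  finitely_generated (ideal_sum (principal_ideal a) (principal_ideal b)).
Proof.
exists 2%N, (fun i : 'I_2 => if i == ord0 then a else b).
apply/seteqP; split=> [_ [_ [_ [[c ->] [d ->] ->]]]|_ [c ->]].
  exists (fun i => if i == ord0 then c else d).
  by rewrite !big_ord_recl big_ord0 addr0.
rewrite !big_ord_recl big_ord0 addr0 /=.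
by exists (a * c ord0), (b * c (lift ord0 ord0)); split=> //; eexists.
Qed.

Lemma proper_ideal_sub_maximal I :
  is_ideal I -> ~ I 1 -> exists2 M, maximal_ideal M & I `<=` M.
Proof.
move=> idI I1.
(* Zorn's lemma is applied to a family closed under unions of all chains, the
   empty one included, so the empty set is added to the proper ideals above I *)
pose P (A : set R) := A = set0 \/ [/\ is_ideal A, I `<=` A & ~ A 1].
have [F FP totF|A [PA maxA]] := @Zorn_bigcup R P.
  have idF X x : F X -> X x -> [/\ is_ideal X, I `<=` X & ~ X 1].
    by move=> FX Xx; case: (FP _ FX) Xx => // ->.
  have [[X FX [x Xx]]|F0] := pselect (exists2 X, F X & X !=set0); last first.
    left; apply/seteqP; split=> // x [X FX Xx].
    by case: F0; exists X => //; exists x.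
  right; have [[X0 _ _] IX _] := idF _ _ FX Xx.
  split; first split.
  - by exists X.
  - move=> y z [Y FY Yy] [Z FZ Zz].
    have [YZ|ZY] := totF _ _ FY FZ.
      by have [[_ ZD _] _ _] := idF _ _ FZ Zz; exists Z => //; apply/ZD/Zz/YZ.
    by have [[_ YD _] _ _] := idF _ _ FY Yy; exists Y => //; apply/YD/ZY.
  - move=> c y [Y FY Yy]; have [[_ _ YM] _ _] := idF _ _ FY Yy.
    by exists Y => //; apply: YM.
  - by move=> y Iy; exists X => //; apply: IX.
  - by move=> [Y FY Y1]; have [_ _] := idF _ _ FY Y1; apply.
have [I0 _ _] := idI.
case: PA => [A0|[idA IA A1]].
  exfalso; apply: (maxA I); last by right; split.
  by rewrite A0; split=> // /(_ 0 I0).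
exists A => //; split=> // [AT|B idB AB]; first by apply: A1; rewrite AT.
have [B1|B1] := pselect (B 1); first by right; apply: ideal1_setT.
left; apply: contrapT => BA; apply: (maxA B); last first.
  by right; split=> //; apply: subset_trans AB.
by split=> // BsA; apply: BA; apply/seteqP.
Qed.

Definition jacobson_closure I : set R :=
  \bigcap_(M in [set M : set R | maximal_ideal M /\ I `<=` M]) M.

Lemma sub_jacobson_closure I : I `<=` jacobson_closure I.
Proof. by move=> x Ix M [_]; apply. Qed.

Lemma jacobson_closureS I J :
  I `<=` J -> jacobson_closure I `<=` jacobson_closure J.
Proof. by move=> IJ x Ix M [maxM JM]; apply: Ix; split=> // y /IJ /JM. Qed.

Lemma jacobson_closure_is_ideal I : is_ideal (jacobson_closure I).
Proof.
split=> [M [[[M0 _ _] _ _] _] //|x y Ix Iy M MI|c x Ix M MI];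
  have [[[_ MD MM] _ _] _] := MI.
  by apply: MD; [apply: Ix|apply: Iy].
by apply: MM; apply: Ix.
Qed.

Lemma jacobson_closure_J_radical I : J_radical_ideal (jacobson_closure I).
Proof.
split; first exact: jacobson_closure_is_ideal.
apply/seteqP; split=> [x Ix M [_]|x Ix M [maxM IM]]; first exact.
by apply: Ix; split=> // y Iy; apply: Iy.
Qed.

Lemma jacobson_closure_proper I :
  is_ideal I -> ~ I 1 -> ~ jacobson_closure I 1.
Proof.
move=> idI I1 J1; have [M maxM IM] := proper_ideal_sub_maximal idI I1.
have [idM + _] := maxM; apply; apply: ideal1_setT => //.
exact: J1.
Qed.

(** A sequence of principal ideals whose closures strictly increase would
    contradict the chain condition; since the zero ideal is proper, some proper
    principal ideal has a closure that admits no proper enlargement. *)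
Lemma exists_maximal_jacobson :
  J_noetherian R -> (1 : R) <> 0 ->
  exists2 a : R, ~ principal_ideal a 1 &
    forall y, ~ principal_ideal y 1 ->
      jacobson_closure (principal_ideal a) `<=`
        jacobson_closure (principal_ideal y) ->
      jacobson_closure (principal_ideal y) `<=`
        jacobson_closure (principal_ideal a).
Proof.
move=> noethR R10; apply: contrapT => nomax.
pose J x := jacobson_closure (principal_ideal x).
have enlarge x : exists y, ~ principal_ideal x 1 ->
    [/\ ~ principal_ideal y 1, J x `<=` J y & ~ J y `<=` J x].
  have [x1|x1] := pselect (principal_ideal x 1); first by exists x.
  apply: contrapT => noy; apply: nomax; exists x => // y y1 xy.
  by apply: contrapT => yx; apply: noy; exists y.
have [f fP] := choice enlarge.
pose u n := iter n f 0.
have u1 n : ~ principal_ideal (u n) 1.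
  elim: n => [[c]|n IHn]; first by rewrite mul0r.
  by have [] := fP _ IHn.
have [n|n|N stab] := noethR (fun n => J (u n)).
- exact: jacobson_closure_J_radical.
- by have [] := fP _ (u1 n).
- have [_ _] := fP _ (u1 N); apply.
  by rewrite -(stab N.+1 (leqnSn N)).
Qed.

End Ideals.

(** Comaximality of a nonunit divisor [s'] of [a] with [b] is refuted by placing
    both in the proper ideal that is the closure of [aR]. *)
Lemma maximal_jacobson_adequate (R : idomainType) (a : R) :
  bezout_domain R -> ~ principal_ideal a 1 ->
  (forall y, ~ principal_ideal y 1 ->
      jacobson_closure (principal_ideal a) `<=`
        jacobson_closure (principal_ideal y) ->
      jacobson_closure (principal_ideal y) `<=`
        jacobson_closure (principal_ideal a)) ->
  adequate a.
Proof.
move=> bezR a1 maxa b.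
have idP := @principal_is_ideal R; have idS x := ideal_sum_is_ideal (idP x) (idP b).
have [ab|ab] :=
  pselect (ideal_sum (principal_ideal a) (principal_ideal b) = [set: R]).
  exists a, 1; split=> // [|s' /(_ 1 (mem_principal_self _)) s'1 []].
    by rewrite mulr1.
  exact: ideal1_setT.
have [g gE] := bezR _ (idS a) (principal_sum_finitely_generated a b).
have g1 : ~ principal_ideal g 1.
  by rewrite -gE => /(ideal1_setT (idS a)).
have ag : principal_ideal a `<=` principal_ideal g.
  rewrite -gE => x ax; exists x, 0; split; rewrite ?addr0 //.
  by exists 0; rewrite mulr0.
have bg : principal_ideal b `<=` principal_ideal g.
  rewrite -gE => x bx; exists 0, x; split; rewrite ?add0r //.
  by exists 0; rewrite mulr0.
exists 1, a; split=> [||s' as' s'T sb]; first by rewrite mul1r.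
  apply: ideal1_setT (idS 1) _; exists 1, 0.
  by split; [exact: mem_principal_self|exists 0; rewrite mulr0|rewrite addr0].
have s'1 : ~ principal_ideal s' 1 by move/(ideal1_setT (idP s')).
apply: (jacobson_closure_proper (idP a) a1).
have : [set: R] 1 by [].
rewrite -sb => -[x [y [s'x /bg gy ->]]].
have [_ JD _] := jacobson_closure_is_ideal (principal_ideal a).
apply: JD.
  apply: (maxa _ s'1); [exact: jacobson_closureS|exact: sub_jacobson_closure].
apply: (maxa _ g1); [exact: jacobson_closureS|exact: sub_jacobson_closure].
Qed.

Local Close Scope classical_set_scope.

Theorem theorem8 (R : idomainType)
    (hBezout : bezout_domain R)
    (hJ : J_noetherian R)
    (hsr : ~ stable_range1 R) :
  exists a : R, a \isn't a GRing.unit /\ adequate a.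
Proof.
have [|a a1 maxa] := exists_maximal_jacobson hJ; first exact/eqP/oner_neq0.
exists a; split; last exact: maximal_jacobson_adequate.
by apply/negP => Ua; apply: a1; exists a^-1; rewrite mulrV.
Qed.
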